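(* Let $(\boldsymbol{U}^k_n)$ be generated by the stochastic parareal (SParareal) scheme (recalled in the context) for the ODE system $\frac{\mathrm{d}\boldsymbol{u}}{\mathrm{d}t}=\boldsymbol{f}(\boldsymbol{u}(t))$ on $[t_0,T]$, $\boldsymbol{u}(t_0)=\boldsymbol{u}_0\in\mathbb{R}^d$, with state-independent perturbations $\boldsymbol{\xi}^k_n(\boldsymbol{U}^k_n)=\boldsymbol{\xi}^k_n$. Assume: (1) (exact fine flow) $\boldsymbol{u}(t_{n+1})=\mathcal{F}_{\Delta T}(\boldsymbol{u}(t_n))$ for $0\le n\le N-1$; (2) (coarse flow) $\mathcal{G}_{\Delta T}$ is a one-step numerical method with uniform local truncation error $\mathcal{O}(\Delta T^{p+1})$, $p\ge 1$, in the sense that $\mathcal{F}_{\Delta T}(\boldsymbol{u})-\mathcal{G}_{\Delta T}(\boldsymbol{u})=c_1(\boldsymbol{u})\Delta T^{p+1}+c_2(\boldsymbol{u})\Delta T^{p+2}+\dots$ with continuously differentiable $c_i$, and there is a constant $C_1>0$ such that for all $\boldsymbol{u},\boldsymbol{v}\in\mathbb{R}^d$ $$\|(\mathcal{F}_{\Delta T}(\boldsymbol{u})-\mathcal{G}_{\Delta T}(\boldsymbol{u}))-(\mathcal{F}_{\Delta T}(\boldsymbol{v})-\mathcal{G}_{\Delta T}(\boldsymbol{v}))\|\le C_1\Delta T^{p+1}\|\boldsymbol{u}-\boldsymbol{v}\|;$$ (3) (Lipschitz coarse flow) there is $L_{\mathcal{G}}>0$ with $\|\mathcal{G}_{\Delta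 T}(\boldsymbol{u})-\mathcal{G}_{\Delta T}(\boldsymbol{v})\|\le L_{\mathcal{G}}\|\boldsymbol{u}-\boldsymbol{v}\|$ for all $\boldsymbol{u},\boldsymbol{v}\in\mathbb{R}^d$; (4) (bounded absolute moments) there are $q\ge 0$, $\tilde r\in\mathbb{N}\cup\{\infty\}$ with $\tilde r\ge 2$, and $C_2>0$ independent of $n$, $k$ and $\Delta T$ such that $\mathbb{E}[\|\boldsymbol{\xi}^k_n\|^r]\le (C_2\Delta T^{q+\frac12})^r$ for $1\le r\le\tilde r$. Let $A=C_1^2\Delta T^{2p+2}(2+\Delta T^{-1})$, $B=L_{\mathcal{G}}^2(1+2\Delta T)$, $\Lambda=C_2^2\Delta T^{2q+1}(2+\Delta T^{-1})$. If $B<1$, then for all $2\le k\le N$ the maximal mean-square error $\hat e^k=\max_{1\le n\le N}\mathbb{E}[\|\boldsymbol{u}(t_n)-\boldsymbol{U}^k_n\|^2]$ satisfies $$\hat e^k\le\hat e^1\left(\frac{A}{1-B}\right)^{k-1}+\frac{\Lambda}{1-B}\sum_{j=0}^{k-2}\left(\frac{A}{1-B}\right)^{j}.$$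
   Context: $\|\cdot\|$ is the infinity norm on $\mathbb{R}^d$, $\|\boldsymbol{u}\|=\max_{i}|u_i|$, and $\mathbb{E}$ is expectation. The vector field $\boldsymbol{f}:\mathbb{R}^d\to\mathbb{R}^d$ is (possibly) nonlinear and smooth enough that the initial value problem has a unique solution $\boldsymbol{u}$ for all initial conditions of interest. The mesh is $t_n=t_0+n\Delta T$, $n=0,\dots,N$, with $\Delta T=(T-t_0)/N$. $\mathcal{F}_{\Delta T},\mathcal{G}_{\Delta T}:\mathbb{R}^d\to\mathbb{R}^d$ are two deterministic maps (the fine and coarse flow maps over one time slice of length $\Delta T$). SParareal scheme: $\boldsymbol{U}^0_0=\boldsymbol{u}_0$; $\boldsymbol{U}^0_{n+1}=\mathcal{G}_{\Delta T}(\boldsymbol{U}^0_n)$ for $0\le n\le N-1$; $\boldsymbol{U}^1_{n+1}=\mathcal{G}_{\Delta T}(\boldsymbol{U}^1_n)+\mathcal{F}_{\Delta T}(\boldsymbol{U}^0_n)-\mathcal{G}_{\Delta T}(\boldsymbol{U}^0_n)$ for $0\le n\le N-1$; $\boldsymbol{U}^{k+1}_{n+1}=\mathcal{G}_{\Delta T}(\boldsymbol{U}^{k+1}_n)+\mathcal{F}_{\Delta T}(\boldsymbol{U}^k_n)-\mathcal{G}_{\Delta T}(\boldsymbol{U}^k_n)+\boldsymbol{\xi}^k_n(\boldsymbol{U}^k_n)$ for $1\le k\le n\le N-1$, where the $\boldsymbol{\xi}^k_n(\boldsymbol{U}^k_n)$ are $\mathbb{R}^d$-valued random variables with $\boldsymbol{\xi}^k_n(\boldsymbol{U}^k_n)\equiv\boldsymbol{0}$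 when $n=k$. State-independent means that $\boldsymbol{\xi}^k_n$ does not depend on the state $\boldsymbol{U}^k_n$; the $\boldsymbol{\xi}^k_n$ need not be independent, identically distributed or centred. Convention: the scheme is exact up to $t_k$ after $k$ iterations, i.e. $\boldsymbol{U}^k_n=\boldsymbol{u}(t_n)$ for $0\le n\le k$ (in particular $\boldsymbol{U}^k_0=\boldsymbol{u}_0$ for all $k$). *)

(* Defs.v *)
From HB Require Import structures.
From mathcomp Require Import all_boot all_order all_algebra.
From mathcomp Require Import all_classical all_reals all_analysis.

Set Implicit Arguments.
Unset Strict Implicit.
Unset Printing Implicit Defensive.

Import Order.TTheory GRing.Theory Num.Theory.
Import numFieldNormedType.Exports.

Local Open Scope classical_set_scope.
Local Open Scope ring_scope.

(* R^d is ['rV[R]_d]; its library norm [`|_|] is the infinity norm. *)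

Definition step_size (R : realType) (t0 T : R) (N : nat) : R := (T - t0) / N%:R.

Definition mesh (R : realType) (t0 T : R) (N n : nat) : R :=
  t0 + n%:R * step_size t0 T N.

(* The derivative is taken relative to [t0, T], hence it is one-sided at the
   endpoints; the values of [u] outside [t0, T] are irrelevant. *)
Definition ivp_solution (R : realType) (d : nat) (f : 'rV[R]_d -> 'rV[R]_d)
    (t0 T : R) (v : 'rV[R]_d) (u : R -> 'rV[R]_d) : Prop :=
  u t0 = v /\
  forall t, t0 <= t <= T ->
    (s - t)^-1 *: (u s - u t) @[s --> within [set` `[t0, T]] t^'] --> f (u t).

(* Existence and uniqueness on [t0, T] for all initial conditions in [D]. *)
Definition ivp_well_posed (R : realType) (d : nat) (f : 'rV[R]_d -> 'rV[R]_d)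
    (t0 T : R) (D : set 'rV[R]_d) : Prop :=
  forall v, D v ->
    (exists u, ivp_solution f t0 T v u) /\
    (forall u1 u2, ivp_solution f t0 T v u1 -> ivp_solution f t0 T v u2 ->
       forall t, t0 <= t <= T -> u1 t = u2 t).

Definition continuously_differentiable (R : realType) (d : nat)
    (c : 'rV[R]_d -> 'rV[R]_d) : Prop :=
  (forall v, differentiable c v) /\ continuous (jacobian c).

(* F_h(v) - G_h(v) = c_1(v) h^(p+1) + c_2(v) h^(p+2) + ... as an asymptotic
   expansion for h -> 0+. A series converging for all small h > 0 is a
   particular case. *)
Definition truncation_expansion (R : realType) (d : nat)
    (F G : R -> 'rV[R]_d -> 'rV[R]_d) (p : nat)
    (c : nat -> 'rV[R]_d -> 'rV[R]_d) : Prop :=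
  forall (v : 'rV[R]_d) (m : nat),
    (fun h => F h v - G h v - \sum_(1 <= i < m.+1) h ^+ (p + i) *: c i v)
      =O_ ((0 : R)^'+) (fun h => h ^+ (p + m.+1)).

(* Measurability for the Borel sigma-algebra of R^d, which is generated by the
   coordinate maps. *)
Definition random_vector (R : realType) (d : nat) (disp : measure_display)
    (Omega : measurableType disp) (X : Omega -> 'rV[R]_d) : Prop :=
  forall i : 'I_d, measurable_fun [set: Omega] (fun w => X w ord0 i).

(* [um n] stands for u(t_n), and [xi k n v w] for the value at the outcome [w]
   of the perturbation xi^k_n(v) of the state [v]. [Fd] and [Gd] are the flow
   maps over one time slice. *)
Record sparareal (R : realType) (d : nat) (disp : measure_display)
    (Omega : measurableType disp) (Fd Gd : 'rV[R]_d -> 'rV[R]_d) (N : nat)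
    (um : nat -> 'rV[R]_d) (xi : nat -> nat -> 'rV[R]_d -> Omega -> 'rV[R]_d)
    (U : nat -> nat -> Omega -> 'rV[R]_d) : Prop := Sparareal {
  sparareal_exact : forall k n w, (n <= k)%N -> (k <= N)%N -> U k n w = um n;
  sparareal_zeroth : forall n w, (n < N)%N -> U 0%N n.+1 w = Gd (U 0%N n w);
  sparareal_first : forall n w, (n < N)%N ->
    U 1%N n.+1 w = Gd (U 1%N n w) + Fd (U 0%N n w) - Gd (U 0%N n w);
  sparareal_next : forall k n w, (1 <= k)%N -> (k <= n)%N -> (n < N)%N ->
    U k.+1 n.+1 w = Gd (U k.+1 n w) + Fd (U k n w) - Gd (U k n w)
                    + xi k n (U k n w) w;
  sparareal_diag : forall k w, (1 <= k)%N -> (k < N)%N ->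
    xi k k (U k k w) w = 0
}.

(* Upper bounds in N \cup {oo}, with [None] for oo. *)
Definition le_order (r : nat) (rt : option nat) : Prop :=
  if rt is Some m then (r <= m)%N else True.

Definition max_ms_error (R : realType) (d : nat) (disp : measure_display)
    (Omega : measurableType disp) (P : probability Omega R) (N : nat)
    (um : nat -> 'rV[R]_d) (U : nat -> nat -> Omega -> 'rV[R]_d) (k : nat)
    : \bar R :=
  \big[maxe/-oo%E]_(1 <= n < N.+1) ('E_P[(fun w => `|um n - U k n w| ^+ 2)%R])%E.

(* Main.v *)
(* Since u(t_{n+1}) = F(u(t_n)), the error at (k+1, n+1) splits into a
   G-difference of the error at (k+1, n), an (F - G)-difference of the error at
   (k, n), and the perturbation. Squaring with Young's inequality of weight dT
   and taking expectations gives
     E(k+1, n+1) <= B E(k+1, n) + A E(k, n) + Lambda.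
   The right-hand side with E(k, n) <= r has the fixed point
   (A r + Lambda) / (1 - B), which therefore bounds E(k+1, n) for all n; iterating
   r |-> (A r + Lambda) / (1 - B) from the deterministic, hence finite, error of
   the first iterate gives the claim. Additivity of the expectation requires the
   iterates to be random vectors: F and G are Lipschitz, and a continuous function
   of a random vector is measurable because open sets of R^d are countable unions
   of rational boxes. *)
Require Import Defs.
From HB Require Import structures.
From mathcomp Require Import all_boot all_order all_algebra.
From mathcomp Require Import all_classical all_reals all_analysis.
From mathcomp Require Import measurable_realfun ring lra.

Set Implicit Arguments.
Unset Strict Implicit.
Unset Printing Implicit Defensive.

Import Order.TTheory GRing.Theory Num.Theory.
Import numFieldNormedType.Exports.

Local Open Scope classical_set_scope.
Local Open Scope ring_scope.

(** * Measurability of functions of random vectors *)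

Lemma random_vector_preimage_open (R : realType) (d : nat)
    (disp : measure_display) (Omega : measurableType disp)
    (X : Omega -> 'rV[R]_d) (O : set 'rV[R]_d) :
  random_vector X -> open O -> measurable (X @^-1` O).
Proof.
move=> mX oO.
pose centre (x : 'rV[rat]_d * nat) : 'rV[R]_d := map_mx ratr x.1.
pose radius (x : 'rV[rat]_d * nat) : R := x.2.+1%:R^-1.
pose box x := ball (centre x) (radius x).
(* The condition that [box x] lies in [O] sits in the sets, not in the index, so the union runs over
   the whole countable type; the other boxes contribute the empty set. *)
have -> : X @^-1` O = \bigcup_x [set w | box x `<=` O /\ box x (X w)].
  apply/seteqP; split=> [w Ow|w [x _] [xO /xO //]].
  have /nbhs_ballP[e /= e0 eO] : nbhs (X w) O by exact: open_nbhs_nbhs.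
  (* With radius below [e / 2], a box whose centre is within one radius of [X w] stays inside the
     [e]-ball around [X w]. *)
  have [n ne] : exists n, n.+1%:R^-1 < e / 2 :> R.
    have e20 : 0 < e / 2 by lra.
    exists (Num.truncn (e / 2)^-1).
    by rewrite invf_plt ?posrE //; apply: truncnS_gt.
  have r0 : 0 < n.+1%:R^-1 :> R by rewrite invr_gt0.
  have qP i : exists q : rat, `|X w ord0 i - ratr q| < n.+1%:R^-1.
    set r := n.+1%:R^-1 in r0 *.
    have /rat_in_itvoo[q] : X w ord0 i - r < X w ord0 i + r by lra.
    rewrite in_itv /= => /andP[? ?].
    by exists q; rewrite ltr_norml; apply/andP; split; lra.
  have [q {}qP] := choice qP.
  exists (\row_i q i, n) => //.
  have boxX : box (\row_i q i, n) (X w).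
    split=> [|i j]; first by rewrite /radius invr_gt0.
    by rewrite !ord1 !mxE /ball /= distrC; exact: qP.
  split=> // v boxv; apply: eO.
  rewrite [e]splitr; apply: (@ball_triangle _ _ (centre (\row_i q i, n))).
    by apply: (le_ball (ltW ne)); exact: ball_sym.
  by apply: (le_ball (ltW ne)).
apply: countable_bigcupT_measurable => // x.
have [xO|nxO] := pselect (box x `<=` O); last first.
  by rewrite [X in measurable X](_ : _ = set0) // -subset0 => w [].
(* A ball of the infinity norm is a product of intervals, so membership is checked on finitely many
   coordinates. *)
rewrite [X in measurable X](_ : _ = \bigcap_(i in [set: 'I_d])
    ((fun w => X w ord0 i) @^-1` ball (centre x ord0 i) (radius x))); last first.
  apply/seteqP; split=> [w [_ [_ xw]] i _|w xw]; first exact: xw.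
  split=> //; split=> [|i j]; first by rewrite invr_gt0.
  by rewrite ord1; exact: xw.
apply: fin_bigcap_measurable => // i _; rewrite -[X in measurable X]setTI.
by apply: (mX i) => //; apply: open_measurable; exact: ball_open.
Qed.

Lemma measurable_continuous_random_vector (R : realType) (d : nat)
    (disp : measure_display) (Omega : measurableType disp)
    (X : Omega -> 'rV[R]_d) (h : 'rV[R]_d -> R) :
  random_vector X -> continuous h ->
  measurable_fun [set: Omega] (fun w => h (X w)).
Proof.
move=> mX ch; apply: (measurability _ (RGenOpens.measurableE R)).
move=> /= _ [_ [a [b ->]] <-]; rewrite setTI.
apply: (@random_vector_preimage_open _ _ _ _ X (h @^-1` `]a, b[)) => //.
by apply: open_comp (interval_open _ _) => // x _; exact: ch.
Qed.

Lemma random_vector_continuous (R : realType) (d : nat)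
    (disp : measure_display) (Omega : measurableType disp)
    (X : Omega -> 'rV[R]_d) (h : 'rV[R]_d -> 'rV[R]_d) :
  random_vector X -> continuous h -> random_vector (fun w => h (X w)).
Proof.
move=> mX ch i.
apply: (measurable_continuous_random_vector (h := fun v => h v ord0 i)) => // v.
apply: (@continuous_comp _ _ _ h (fun v => v ord0 i)); first exact: ch.
exact: coord_continuous.
Qed.

Lemma random_vectorD (R : realType) (d : nat)
    (disp : measure_display) (Omega : measurableType disp)
    (X Y : Omega -> 'rV[R]_d) :
  random_vector X -> random_vector Y -> random_vector (fun w => X w + Y w).
Proof.
move=> mX mY i; under eq_fun do rewrite mxE.
exact: measurable_funD.
Qed.

Lemma lipschitz_continuous (R : realType) (V W : normedModType R) (K : R)
    (h : V -> W) :
  0 < K -> (forall x y, `|h x - h y| <= K * `|x - y|) -> continuous h.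
Proof.
move=> K0 hK x; apply/cvgrPdist_lt => e e0; near=> y.
apply: le_lt_trans (hK x y) _; rewrite -ltr_pdivlMl //.
near: y; apply: cvgr_dist_lt; first exact: cvg_id.
by rewrite mulr_gt0 // invr_gt0.
Unshelve. all: by end_near.
Qed.

Lemma measurable_normr_random_vector (R : realType) (d : nat)
    (disp : measure_display) (Omega : measurableType disp)
    (X : Omega -> 'rV[R]_d) (v : 'rV[R]_d) (n : nat) :
  random_vector X -> measurable_fun [set: Omega] (fun w => `|v - X w| ^+ n).
Proof.
move=> mX; apply: measurable_funX.
apply: (measurable_continuous_random_vector (h := fun z => `|v - z|)) => //.
apply: (@lipschitz_continuous R 'rV[R]_d R^o 1) => // x y.
rewrite mul1r -normrN opprB (le_trans (ler_dist_dist _ _)) //.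
by rewrite opprB addrC subrKA.
Qed.

(** Nonnegativity replaces integrability: the expectations may be infinite, and linearity still
    holds in the extended reals. *)
Lemma expectation_le_comb3 (R : realType) (disp : measure_display)
    (Omega : measurableType disp) (P : probability Omega R)
    (X Y Z S : Omega -> R) (a b c : R) :
  measurable_fun setT X -> measurable_fun setT Y -> measurable_fun setT Z ->
  measurable_fun setT S ->
  (forall w, 0 <= X w) -> (forall w, 0 <= Y w) -> (forall w, 0 <= Z w) ->
  (forall w, 0 <= S w) -> 0 <= a -> 0 <= b -> 0 <= c ->
  (forall w, S w <= a * X w + b * Y w + c * Z w) ->
  ('E_P[S] <= a%:E * 'E_P[X] + b%:E * 'E_P[Y] + c%:E * 'E_P[Z])%E.
Proof.
move=> mX mY mZ mS X0 Y0 Z0 S0 a0 b0 c0 le; rewrite unlock.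
rewrite -!ge0_integralZl_EFin //; try exact/measurable_EFinP;
  try by move=> w _; rewrite lee_fin.
have aX0 w : (0 <= a%:E * (X w)%:E)%E by rewrite -EFinM lee_fin mulr_ge0.
have bY0 w : (0 <= b%:E * (Y w)%:E)%E by rewrite -EFinM lee_fin mulr_ge0.
have cZ0 w : (0 <= c%:E * (Z w)%:E)%E by rewrite -EFinM lee_fin mulr_ge0.
have m (r : R) (W : Omega -> R) : measurable_fun setT W ->
    measurable_fun setT (fun w => r%:E * (W w)%:E)%E.
  by move=> mW; apply: (@measurable_funeM _ _ _ _ (EFin \o W)); exact/measurable_EFinP.
rewrite -!ge0_integralD //; try exact: m; try exact: emeasurable_funD (m _ _ _) (m _ _ _).
  2: by move=> w _; exact: adde_ge0.
apply: ge0_le_integral => //.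
- by move=> w _; rewrite lee_fin.
- exact/measurable_EFinP.
- by do 2 ?apply: emeasurable_funD; exact: m.
- by move=> w _; rewrite lee_fin.
Qed.

(* Young's inequality [2 x y <= t x^2 + y^2 / t] for the two cross terms with
   [x], and [2 y z <= y^2 + z^2] for the third. *)
Lemma sqr_trinomial_le (R : realType) (t x y z : R) : 0 < t ->
  (x + y + z) ^+ 2 <= (1 + 2 * t) * x ^+ 2 + (2 + t^-1) * (y ^+ 2 + z ^+ 2).
Proof.
move=> t0; have young s : 2 * x * s <= t * x ^+ 2 + t^-1 * s ^+ 2.
  rewrite -subr_ge0 (_ : _ - _ = t^-1 * (t * x - s) ^+ 2); last first.
    by field; rewrite gt_eqF.
  by rewrite mulr_ge0 ?sqr_ge0 // invr_ge0 ltW.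
have := young y; have := young z; have := sqr_ge0 (y - z); nra.
Qed.

(** * Measurability and determinism of the iterates *)

Lemma sparareal_random_vector (R : realType) (d : nat)
    (disp : measure_display) (Omega : measurableType disp)
    (Fd Gd : 'rV[R]_d -> 'rV[R]_d) (N : nat) (um : nat -> 'rV[R]_d)
    (xi : nat -> nat -> Omega -> 'rV[R]_d)
    (U : nat -> nat -> Omega -> 'rV[R]_d) :
  continuous Fd -> continuous Gd ->
  (forall k n, (1 <= k)%N -> (k <= n)%N -> (n < N)%N ->
     random_vector (xi k n)) ->
  sparareal Fd Gd N um (fun k n _ => xi k n) U ->
  forall k n, (k <= N)%N -> (n <= N)%N -> random_vector (U k n).
Proof.
move=> cF cG mxi [Uexact U0 U1 Unext _].
have mexact k n : (n <= k)%N -> (k <= N)%N -> random_vector (U k n).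
  move=> nk kN i; under eq_fun do rewrite Uexact //.
  exact: measurable_cst.
have cNG : continuous (fun v => - Gd v) by move=> v; apply: (continuousN (cG v)).
have mparareal (X Y : Omega -> 'rV[R]_d) : random_vector X -> random_vector Y ->
    random_vector (fun w => Gd (X w) + Fd (Y w) - Gd (Y w)).
  move=> mX mY; apply: random_vectorD; last exact: (random_vector_continuous mY cNG).
  apply: random_vectorD; first exact: random_vector_continuous mX cG.
  exact: random_vector_continuous mY cF.
elim=> [|k IHk]; elim=> [|n IHn] kN nN; try exact: mexact.
- rewrite (_ : U 0 n.+1 = fun w => Gd (U 0 n w)); last by apply/funext => w; exact: U0.
  exact: random_vector_continuous (IHn kN (ltnW nN)) cG.
have [nk|kn] := leqP n k; first exact: mexact.
(* The first iteration obeys its own rule, without perturbation. *)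
case: k => [|k] in IHk IHn kN kn *.
  rewrite (_ : U 1 n.+1 = fun w => Gd (U 1 n w) + Fd (U 0 n w) - Gd (U 0 n w)).
    exact: mparareal (IHn kN (ltnW nN)) (IHk n (ltnW kN) (ltnW nN)).
  by apply/funext => w; exact: U1.
rewrite (_ : U k.+2 n.+1 = fun w => Gd (U k.+2 n w) + Fd (U k.+1 n w)
                                   - Gd (U k.+1 n w) + xi k.+1 n w).
  apply: random_vectorD; last exact: mxi (ltnW kn) _.
  exact: mparareal (IHn kN (ltnW nN)) (IHk n (ltnW kN) (ltnW nN)).
by apply/funext => w; apply: Unext => //; exact: ltnW.
Qed.

(** Noise enters only from the second iteration on. This makes [e 1] finite, so the error bounds can
    be iterated in the reals. *)
Lemma sparareal_first_deterministic (R : realType) (d : nat)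
    (disp : measure_display) (Omega : measurableType disp)
    (Fd Gd : 'rV[R]_d -> 'rV[R]_d) (N : nat) (um : nat -> 'rV[R]_d)
    (xi : nat -> nat -> 'rV[R]_d -> Omega -> 'rV[R]_d)
    (U : nat -> nat -> Omega -> 'rV[R]_d) :
  sparareal Fd Gd N um xi U ->
  (0 < N)%N -> forall n, (n <= N)%N -> exists v, U 1%N n = cst v.
Proof.
move=> [Uexact U0 U1 _ _] N0 n nN.
suff [v0 [v1 [_ ->]]] : exists v0 v1, U 0%N n = cst v0 /\ U 1%N n = cst v1.
  by exists v1.
elim: n nN => [|n IHn] nN.
  by exists (um 0%N), (um 0%N); split; apply/funext => w; exact: Uexact.
have [v0 [v1 [E0 E1]]] := IHn (ltnW nN).
exists (Gd v0), (Gd v1 + Fd v0 - Gd v0).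
by split; apply/funext => w; rewrite ?U0 ?U1 // E0 ?E1.
Qed.

(** * Error recursion and its iteration *)

Theorem corollary4p7 (R : realType) (d : nat) (disp : measure_display)
    (Omega : measurableType disp) (P : probability Omega R)
    (f : 'rV[R]_d -> 'rV[R]_d) (t0 T : R) (N : nat)
    (D : set 'rV[R]_d) (u0 : 'rV[R]_d) (u : R -> 'rV[R]_d)
    (F G : R -> 'rV[R]_d -> 'rV[R]_d)
    (xi : nat -> nat -> Omega -> 'rV[R]_d)
    (U : nat -> nat -> Omega -> 'rV[R]_d)
    (p : nat) (c : nat -> 'rV[R]_d -> 'rV[R]_d)
    (C1 LG q C2 : R) (rt : option nat) :
  let dT := step_size t0 T N in
  let um := fun n => u (mesh t0 T N n) in
  t0 < T -> (0 < N)%N ->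
  ivp_well_posed f t0 T D -> D u0 -> ivp_solution f t0 T u0 u ->
  (forall k n, (1 <= k)%N -> (k <= n)%N -> (n < N)%N ->
     random_vector (xi k n)) ->
  sparareal (F dT) (G dT) N um (fun k n _ => xi k n) U ->
  (forall n, (n < N)%N -> um n.+1 = F dT (um n)) ->
  (1 <= p)%N ->
  (forall i, (1 <= i)%N -> continuously_differentiable (c i)) ->
  truncation_expansion F G p c ->
  0 < C1 ->
  (forall v w : 'rV[R]_d,
     `|(F dT v - G dT v) - (F dT w - G dT w)| <= C1 * dT ^+ p.+1 * `|v - w|) ->
  0 < LG ->
  (forall v w : 'rV[R]_d, `|G dT v - G dT w| <= LG * `|v - w|) ->
  0 <= q -> le_order 2 rt -> 0 < C2 ->
  (forall k n r, (1 <= k)%N -> (k <= n)%N -> (n < N)%N ->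
     (1 <= r)%N -> le_order r rt ->
     ('E_P[(fun w => `|xi k n w| ^+ r)%R] <= ((C2 * dT `^ (q + 2^-1)) ^+ r)%:E)%E) ->
  let A := C1 ^+ 2 * dT ^+ (2 * p + 2) * (2 + dT^-1) in
  let B := LG ^+ 2 * (1 + 2 * dT) in
  let Lambda := C2 ^+ 2 * dT `^ (2 * q + 1) * (2 + dT^-1) in
  let e := max_ms_error P N um U in
  B < 1 ->
  forall k, (2 <= k)%N -> (k <= N)%N ->
    (e k <= e 1%N * ((A / (1 - B)) ^+ (k - 1))%:E
            + (Lambda / (1 - B) *
               \sum_(0 <= j < (k - 2).+1) (A / (1 - B)) ^+ j)%:E)%E.
Proof.
move=> dT um t0T N0 _ _ _ mxi sp umF p1 _ _ C10 FGlip LG0 Glip q0 rt2 C20 xiP.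
move=> A B Lambda e B1.
have dT0 : 0 < dT by rewrite divr_gt0 ?subr_gt0 ?ltr0n.
(* The common factor of [A] and [Lambda]: the coefficient that Young's inequality of weight [dT]
   puts on the last two squares. *)
pose kappa := 2 + dT^-1.
have kappa0 : 0 < kappa by rewrite addr_gt0 // invr_gt0.
have A0 : 0 <= A by rewrite mulr_ge0 ?(ltW kappa0) // mulr_ge0 // exprn_ge0 // ltW.
have B0 : 0 <= B by rewrite mulr_ge0 ?sqr_ge0 //; lra.
have L0 : 0 <= Lambda.
  by rewrite mulr_ge0 ?(ltW kappa0) // mulr_ge0 ?sqr_ge0 ?powR_ge0.
have B10 : 0 < 1 - B by lra.
pose K := C1 * dT ^+ p.+1.
have K0 : 0 < K by rewrite mulr_gt0 // exprn_gt0.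
have AE : A = kappa * K ^+ 2.
  by rewrite /K exprMn -exprM mulnC mulnS addnC mulrC.
have LE : Lambda = kappa * (C2 * dT `^ (q + 2^-1)) ^+ 2.
  rewrite /Lambda exprMn mulrC; congr (_ * (_ * _)).
  by rewrite -powR_mulrn ?powR_ge0 // -powRrM; congr (_ `^ _); field.
have cG : continuous (G dT) by exact: lipschitz_continuous LG0 Glip.
have cF : continuous (F dT).
  have cFG := lipschitz_continuous K0 FGlip.
  rewrite (_ : F dT = fun v => F dT v - G dT v + G dT v); last first.
    by apply/funext => v; rewrite subrK.
  by move=> v; apply: (continuousD (cFG v) (cG v)).
have mU := sparareal_random_vector cF cG mxi sp.
have [Uexact _ _ Unext _] := sp.
pose E k n := ('E_P[(fun w => `|um n - U k n w| ^+ 2)%R])%E.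
have Eexact k n : (n <= k)%N -> (k <= N)%N -> E k n = 0%E.
  move=> nk kN; rewrite /E (_ : (fun _ => _) = cst 0) ?expectation_cst //.
  by apply/funext => w; rewrite Uexact // subrr normr0 expr0n.
have xi2 k n : (1 <= k)%N -> (k <= n)%N -> (n < N)%N ->
    (kappa%:E * 'E_P[(fun w => `|xi k n w| ^+ 2)%R] <= Lambda%:E)%E.
  by move=> k1 kn nN; rewrite LE EFinM lee_pmul2l ?lte_fin // xiP.
have step k n : (1 <= k)%N -> (k <= n)%N -> (n < N)%N ->
    (E k.+1 n.+1 <= B%:E * E k.+1 n + A%:E * E k n + Lambda%:E)%E.
  (* Undoing the second-moment bound on the noise leaves a pure combination of three expectations,
     provable pointwise. *)
  move=> k1 kn nN; apply: le_trans (leeD2l _ (xi2 _ _ k1 kn nN)).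
  have kN := leq_ltn_trans kn nN.
  apply: expectation_le_comb3 => //; try exact: ltW.
  1,2,4: by apply: measurable_normr_random_vector; apply: mU => //; exact: ltnW.
    rewrite (_ : (fun w => _) = fun w => `|0 - xi k n w| ^+ 2).
      by apply: measurable_normr_random_vector; exact: mxi.
    by apply/funext => w; rewrite sub0r normrN.
  move=> w; rewrite Unext // umF //.
  set x := G dT (um n) - G dT (U k.+1 n w).
  set y := (F dT (um n) - G dT (um n)) - (F dT (U k n w) - G dT (U k n w)).
  rewrite (_ : F dT (um n) - _ = x + y - xi k n w); last first.
    by apply/rowP => i; rewrite /x /y !mxE; ring.
  have x2 : `|x| ^+ 2 <= LG ^+ 2 * `|um n - U k.+1 n w| ^+ 2.
    by rewrite -exprMn lerXn2r ?nnegrE ?mulr_ge0 ?(ltW LG0) // Glip.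
  have y2 : `|y| ^+ 2 <= K ^+ 2 * `|um n - U k n w| ^+ 2.
    by rewrite -exprMn lerXn2r ?nnegrE ?(mulr_ge0 (ltW K0)) //; exact: FGlip.
  apply: (@le_trans _ _ ((`|x| + `|y| + `|xi k n w|) ^+ 2)).
    rewrite lerXn2r ?nnegrE ?addr_ge0 //.
    by rewrite (le_trans (ler_normB _ _)) // lerD2r ler_normD.
  apply: le_trans (sqr_trinomial_le _ _ _ dT0) _.
  rewrite -/kappa mulrDr addrA lerD2r AE /B [LG ^+ 2 * _]mulrC.
  rewrite -(mulrA (1 + 2 * dT)) -(mulrA kappa).
  by rewrite lerD ?ler_wpM2l ?(ltW kappa0) //; lra.
have iter k r : (1 <= k)%N -> (k < N)%N -> 0 <= r ->
    (forall n, (n <= N)%N -> (E k n <= r%:E)%E) ->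
    forall n, (n <= N)%N -> (E k.+1 n <= ((A * r + Lambda) / (1 - B))%:E)%E.
  move=> k1 kN r0 Ekr.
  have s0 : 0 <= (A * r + Lambda) / (1 - B).
    by rewrite divr_ge0 ?(ltW B10) // addr_ge0 // mulr_ge0.
  elim=> [|n IHn] nN; first by rewrite Eexact ?lee_fin.
  (* For [n <= k] the iterate at [(k.+1, n.+1)] is exact; the recursion is needed only beyond the
     diagonal. *)
  have [nk|kn] := leqP n k; first by rewrite Eexact ?lee_fin.
  apply: le_trans (step k n k1 (ltnW kn) nN) _.
  (* The bound is the fixed point of [s = B * s + A * r + Lambda], hence it propagates unchanged
     from [n] to [n.+1]. *)
  have -> : (A * r + Lambda) / (1 - B) =
      B * ((A * r + Lambda) / (1 - B)) + A * r + Lambda.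
    by field; rewrite gt_eqF.
  rewrite !EFinD !EFinM leeD2r // leeD //.
    by rewrite lee_pmul // ?lee_fin // ?IHn ?(ltnW nN) // expectation_ge0.
  by rewrite lee_pmul // ?lee_fin // ?Ekr ?(ltnW nN) // expectation_ge0.
have [e1 [e10 e1E]] : exists e1 : R, 0 <= e1 /\ e 1%N = e1%:E.
  have e10 : (0 <= e 1%N)%E.
    (* The maximum starts from [-oo], so its sign comes from the entry [n = 1], present because
       [0 < N]. *)
    apply: (@le_trans _ _ (E 1%N 1%N)); first by rewrite expectation_ge0.
    by apply: (le_bigmax_seq _ 1%N) => //; rewrite mem_index_iota.
  exists (fine (e 1%N)); rewrite fine_ge0 // fineK ?ge0_fin_numE //.
  rewrite /e /max_ms_error big_nat; apply: bigmax_lt => // n /andP[_ nN].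
  have [v ->] := sparareal_first_deterministic sp N0 nN.
  by rewrite [ltLHS](expectation_cst P (`|um n - v| ^+ 2)) ltry.
have E1le n : (n <= N)%N -> (E 1%N n <= e1%:E)%E.
  (* The maximum leaves out [n = 0], where the error vanishes. *)
  case: n => [|n] nN; first by rewrite Eexact ?lee_fin.
  rewrite -e1E.
  by apply: (le_bigmax_seq _ n.+1) => //; rewrite mem_index_iota.
pose rho := A / (1 - B); pose lam := Lambda / (1 - B).
have rho0 : 0 <= rho by rewrite divr_ge0 // ltW.
have lam0 : 0 <= lam by rewrite divr_ge0 // ltW.
(* The closed form of [i] steps of [r |-> rho * r + lam] from [e1]; it bounds iteration [i.+1]. *)
pose bound i := e1 * rho ^+ i + lam * \sum_(0 <= j < i) rho ^+ j.
have bound0 i : 0 <= bound i.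
  apply: addr_ge0; apply: mulr_ge0 => //; first exact: exprn_ge0.
  by apply: sumr_ge0 => j _; exact: exprn_ge0.
have boundS i : bound i.+1 = (A * bound i + Lambda) / (1 - B).
  rewrite mulrDl -/lam mulrAC -/rho /bound big_nat_recl // expr0.
  under eq_bigr do rewrite exprS.
  by rewrite -mulr_sumr exprS; ring.
have bounded i : (i < N)%N -> forall n, (n <= N)%N -> (E i.+1 n <= (bound i)%:E)%E.
  elim: i => [|i IHi] iN n nN.
    by rewrite /bound big_geq // mulr0 addr0 expr0 mulr1; exact: E1le.
  by rewrite boundS; apply: iter => //; apply: IHi; exact: ltnW.
(* For iteration [k.+2] both the exponent and the number of summands are [k.+1], so the claim is
   [bound k.+1]. *)
case=> [//|[//|k]] _ kN; rewrite e1E -EFinM -EFinD !subSS !subn0.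
rewrite /e /max_ms_error big_nat; apply: bigmax_le; first exact: leNye.
by move=> n /andP[_ nN]; exact: bounded.
Qed.
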